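(* Let $N\ge 1$, let $\nu_1,\dots,\nu_{N-1}\in\mathbb{R}$, let $A=\sum_{i=1}^{N-1}\nu_iE_{i,i+1}$, $J=\sum_{i=1}^N (N-i)E_{i,i}$, $B=A(I_N+A)^{-1}$, and $W(x)=e^{-x^2}e^{Bx^2}e^{B^{T}x^2}$, $x\in\mathbb{R}$. Let $(\widehat P_k)_{k\in\mathbb N}$ be the monic matrix orthogonal polynomials with respect to $W$, let $P_k(x)=\left[(I_N+A)^{-1/2}\right]^{2k+1}\widehat P_k(x)$, and let $C_k,D_k$ be constant matrices such that for all $x\in\mathbb R$ and $k\in\mathbb N$ $$P_k(x)e^{Bx^2}=\oint_{\gamma}z^{-2J}C_kz^{2J}e^{-z^2+2zx}\frac{dz}{z^{k+1}},\qquad P_k(x)e^{Bx^2}=e^{x^2}\int_{\mathcal I}w^{2J}D_kw^{-2J}e^{w^2-2xw}w^k\,dw .$$ Then the Hermite-type Christoffel–Darboux kernel $K_n(x,y)$ associated with $W$ can be written as $$K_n(x,y)=e^{(x^2-y^2)/2}\int_{\mathcal I}dw\oint_{\gamma}dz\;M_n(z,w)\,e^{w^2-2xw-z^2+2zy},$$ where $$M_n(z,w)=z^{2J}\left[\sum_{k=0}^{n-1}C_k^{T}z^{-2J}\|P_k\|_{W}^{-2}w^{2J}D_k\left(\frac wz\right)^k\right]\frac1z\,w^{-2J}.$$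
   Context: $E_{i,j}$ is the $N\times N$ elementary matrix with $1$ at entry $(i,j)$ and $0$ elsewhere; $T$ denotes the transpose. Since $A$ is nilpotent, $(I_N+A)^{-1/2}$ is defined by the (finite) binomial series. The matrix-valued inner product is $\langle F,G\rangle_W=\int_{\mathbb{R}}F(x)W(x)G^{T}(x)\,dx$; monic matrix orthogonal polynomials satisfy $\widehat P_k(x)=x^kI_N+\cdots$ and $\langle\widehat P_k,\widehat P_m\rangle_W=0$ for $k\neq m$. $\|P_k\|_W^2:=\langle P_k,P_k\rangle_W$ (a positive definite matrix), $\|P_k\|_W^{-2}$ is its inverse and $\|P_k\|_W^{-1}$ the positive square root of that inverse. The Hermite-type Christoffel–Darboux kernel is $K_n(x,y):=\sum_{k=0}^{n-1}\Phi_k^{T}(y)\Phi_k(x)$ with $\Phi_k(x):=e^{-x^2/2}\|P_k\|_W^{-1}P_k(x)e^{Bx^2}$. For a matrix $M$, $z^{M}:=e^{M\log z}$ with branch cut of $\log$ on the negative real axis. The contour $\gamma$ comes from $-\infty$ below the negative real axis, goes counterclockwise around the origin, and returns to $-\infty$ above the negative real axis; $\mathcal I=L+i\mathbb R$ (oriented upwards), with $L>0$ such that $\gamma$ lies to the left of $\mathcal I$ and does not intersect it. (Matrices $C_k,D_k$ with the required property exist.) *)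

(* Defs.v *)
From HB Require Import structures.
From mathcomp Require Import all_boot all_order all_algebra.
From mathcomp Require Import complex.
From mathcomp Require Import all_classical all_reals all_analysis.

Set Implicit Arguments.
Unset Strict Implicit.
Unset Printing Implicit Defensive.

Import Order.TTheory GRing.Theory Num.Theory.
Import numFieldNormedType.Exports.

Local Open Scope classical_set_scope.
Local Open Scope ring_scope.
Local Open Scope complex_scope.

(* Throughout, matrices are N x N with N = n.+1, and row or column i of the
   mathematics (1 <= i <= N) is the ordinal i - 1 : 'I_n.+1. *)

(* The limit of the exponential series is taken entrywise. *)
Definition expm (K : numFieldType) (n : nat) (M : 'M[K]_n.+1) : 'M[K]_n.+1 :=
  \matrix_(i, j)
    limn (fun m => (\sum_(0 <= k < m) (k`!%:R)^-1 *: M ^+ k) i j).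

Section RealMatrices.
Variables (R : realType) (n : nat).

Definition mxA (nu : 'I_n -> R) : 'M[R]_n.+1 :=
  \sum_(i < n) nu i *: delta_mx (widen_ord (leqnSn n) i) (lift ord0 i).

(* N - i becomes n - i after the index shift. *)
Definition mxJ : 'M[R]_n.+1 := \sum_(i < n.+1) (n - i)%:R *: delta_mx i i.

Definition mxB (nu : 'I_n -> R) : 'M[R]_n.+1 :=
  mxA nu *m invmx (1%:M + mxA nu).

Definition gbinom (a : R) (k : nat) : R :=
  (\prod_(0 <= l < k) (a - l%:R)) / k`!%:R.

(* (I + X)^a for X nilpotent, so that X ^+ n.+1 = 0 and the binomial series
   stops. *)
Definition binomial_mx (a : R) (X : 'M[R]_n.+1) : 'M[R]_n.+1 :=
  \sum_(k < n.+1) gbinom a k *: X ^+ k.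

Definition weight (nu : 'I_n -> R) (x : R) : 'M[R]_n.+1 :=
  expR (- x ^+ 2) *:
    (expm (x ^+ 2 *: mxB nu) *m expm (x ^+ 2 *: (mxB nu)^T)).

Definition inner (W F G : R -> 'M[R]_n.+1) : 'M[R]_n.+1 :=
  \matrix_(i, j)
    \int[lebesgue_measure]_x ((F x *m W x *m (G x)^T) i j).

(* A matrix polynomial is a matrix with polynomial entries. *)
Definition mxeval (P : 'M[{poly R}]_n.+1) (x : R) : 'M[R]_n.+1 :=
  map_mx (fun p => p.[x]) P.

Definition monic_mxpoly (k : nat) (P : 'M[{poly R}]_n.+1) : Prop :=
  (forall i j, (size (P i j) <= k.+1)%N) /\
  map_mx (fun p : {poly R} => p`_k) P = 1%:M.

Definition monic_MOP (W : R -> 'M[R]_n.+1) (Phat : nat -> 'M[{poly R}]_n.+1) :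
    Prop :=
  (forall k, monic_mxpoly k (Phat k)) /\
  (forall k m, k != m -> inner W (mxeval (Phat k)) (mxeval (Phat m)) = 0).

Definition Ppoly (nu : 'I_n -> R) (Phat : nat -> 'M[{poly R}]_n.+1)
    (k : nat) (x : R) : 'M[R]_n.+1 :=
  binomial_mx (- 2^-1) (mxA nu) ^+ (2 * k + 1) *m mxeval (Phat k) x.

Definition normsq (W P : R -> 'M[R]_n.+1) : 'M[R]_n.+1 := inner W P P.

Definition pos_def (S : 'M[R]_n.+1) : Prop :=
  S^T = S /\ forall v : 'rV[R]_n.+1, v != 0 -> 0 < (v *m S *m v^T) 0 0.

(* This determines S uniquely from M. *)
Definition is_pos_sqrt (M S : 'M[R]_n.+1) : Prop := pos_def S /\ S *m S = M.

(* S k stands for the matrix ||P_k||_W^{-1}. *)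
Definition Phi (nu : 'I_n -> R) (Phat : nat -> 'M[{poly R}]_n.+1)
    (S : nat -> 'M[R]_n.+1) (k : nat) (x : R) : 'M[R]_n.+1 :=
  expR (- x ^+ 2 / 2) *:
    (S k *m Ppoly nu Phat k x *m expm (x ^+ 2 *: mxB nu)).

Definition CDkernel (nu : 'I_n -> R) (Phat : nat -> 'M[{poly R}]_n.+1)
    (S : nat -> 'M[R]_n.+1) (m : nat) (x y : R) : 'M[R]_n.+1 :=
  \sum_(k < m) (Phi nu Phat S k y)^T *m Phi nu Phat S k x.

End RealMatrices.

Section ComplexPlane.
Variable R : realType.

Definition cexp (z : R[i]) : R[i] :=
  (expR (complex.Re z))%:C * (cos (complex.Im z) +i* sin (complex.Im z)).

(* Principal values: the argument is in ]-pi, pi], cut on the negative real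
   axis. *)
Definition carg (z : R[i]) : R :=
  let t := acos (complex.Re z / ComplexField.Normc.normc z) in
  if 0 <= complex.Im z then t else - t.

Definition clog (z : R[i]) : R[i] := ln (ComplexField.Normc.normc z) +i* carg z.

Definition cpowm (n : nat) (z : R[i]) (M : 'M[R[i]]_n.+1) : 'M[R[i]]_n.+1 :=
  expm (clog z *: M).

Definition cmx (n : nat) (M : 'M[R]_n.+1) : 'M[R[i]]_n.+1 :=
  map_mx (fun r => r%:C) M.

Definition cintegrable (f : R -> R[i]) : Prop :=
  lebesgue_measure.-integrable [set: R] (fun t => (complex.Re (f t))%:E) /\
  lebesgue_measure.-integrable [set: R] (fun t => (complex.Im (f t))%:E).

Definition cintegral (f : R -> R[i]) : R[i] :=
  (\int[lebesgue_measure]_t complex.Re (f t)) +i*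
  (\int[lebesgue_measure]_t complex.Im (f t)).

(* Velocity of a path; at the corners of a piecewise C^1 path the value is
   arbitrary, which does not affect path integrals. *)
Definition velocity (g : R -> R[i]) (t : R) : R[i] :=
  derive1 (fun s => complex.Re (g s)) t +i* derive1 (fun s => complex.Im (g s)) t.

(* Integrals of matrix-valued functions along a path parametrized by the whole
   real line; path_integrable is absolute convergence. *)
Definition path_integrable (n : nat) (g : R -> R[i])
    (F : R[i] -> 'M[R[i]]_n.+1) : Prop :=
  forall i j, cintegrable (fun t => F (g t) i j * velocity g t).

Definition path_integral (n : nat) (g : R -> R[i])
    (F : R[i] -> 'M[R[i]]_n.+1) : 'M[R[i]]_n.+1 :=
  \matrix_(i, j) cintegral (fun t => F (g t) i j * velocity g t).

Definition piecewise_C1 (f : R -> R) : Prop :=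
  continuous f /\
  exists E : set R,
    [/\ forall a b : R, finite_set (E `&` [set t | a <= t <= b]),
        forall t : R, ~ E t ->
          derivable f t 1 /\ {for t, continuous (derive1 f)}
      & forall t : R, cvg (derive1 f s @[s --> t^'-]) /\
                      cvg (derive1 f s @[s --> t^'+])].

(* A path from -oo, below the negative real axis, to -oo, above it. As it stays
   in the plane slit along ]-oo, 0], it must pass from the lower side of the
   slit to the upper one by turning counterclockwise around the origin. The two
   ends are asymptotic in direction to the negative real axis. *)
Definition loop_contour (g : R -> R[i]) : Prop :=
  let u := fun t => complex.Re (g t) in
  let v := fun t => complex.Im (g t) in
  [/\ piecewise_C1 u /\ piecewise_C1 v,
      forall t, ~ (v t = 0 /\ u t <= 0),
      (\forall t \near -oo, v t < 0) /\ (\forall t \near +oo, 0 < v t),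
      (u t @[t --> -oo] --> -oo) /\ (u t @[t --> +oo] --> -oo)
    & (v t / u t @[t --> -oo] --> (0 : R)) /\
      (v t / u t @[t --> +oo] --> (0 : R))].

Definition vertical_path (L : R) : R -> R[i] := fun s => L +i* s.

End ComplexPlane.

(* Q k stands for ||P_k||_W^{-2} and J2 for 2J, as complex matrices. *)
Definition Mker (R : realType) (n : nat) (J2 : 'M[R[i]]_n.+1)
    (C D Q : nat -> 'M[R[i]]_n.+1) (m : nat) (z w : R[i]) : 'M[R[i]]_n.+1 :=
  cpowm z J2 *m
  (\sum_(k < m) (w / z) ^+ k *:
     ((C k)^T *m cpowm z (- J2) *m Q k *m cpowm w J2 *m D k)) *m
  (z^-1 *: cpowm w (- J2)).

(* Main.v *)
Require Import Defs.
From mathcomp Require Import all_boot all_order all_algebra.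
From mathcomp Require Import complex ring.
From mathcomp Require Import all_classical all_reals all_analysis.

(* Squaring the square root ||P_k||^-1 turns K_n into
   e^(-(x^2+y^2)/2) sum_k (P_k(y) e^(B y^2))^T ||P_k||^-2 P_k(x) e^(B x^2), into
   which the two integral representations are substituted. As 2J is symmetric,
   the resulting integrand is the one of the theorem, and it is a finite sum of
   products of a function of z and a function of w. Linearity of each of the
   two integrals therefore suffices, without any Fubini argument. *)

Set Implicit Arguments.
Unset Strict Implicit.
Unset Printing Implicit Defensive.

Import Order.TTheory GRing.Theory Num.Theory.
Import numFieldNormedType.Exports.
Local Open Scope ring_scope.
Local Open Scope complex_scope.

(** The addition formulas for [expR], [cos] and [sin]. It splits the exponential of the double
    integrand into a factor in z and a factor in w. *)
Lemma cexpD (R : realType) (a b : R[i]) : cexp (a + b) = cexp a * cexp b.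
Proof.
case: a => ar ai; case: b => br bi; rewrite /cexp /= expRD cosD sinD.
by apply/eqP; rewrite eq_complex /=; apply/andP; split; apply/eqP; ring.
Qed.

Section Matrices.

Lemma trmx_exp (K : comNzRingType) (n : nat) (M : 'M[K]_n.+1) (k : nat) :
  (M ^+ k)^T = M^T ^+ k.
Proof.
elim: k => [|k IHk]; first by rewrite !expr0 trmx1.
by rewrite exprS exprSr -!mulmxE trmx_mul IHk.
Qed.

(** The two entries compared have the same sequence of partial sums, hence the same [limn], whether
    or not the series converges. *)
Lemma trmx_expm (K : numFieldType) (n : nat) (M : 'M[K]_n.+1) :
  (expm M)^T = expm M^T.
Proof.
apply/matrixP => i j; rewrite !mxE; congr (limn _); apply/funext => m.
rewrite !summxE; apply: eq_bigr => k _.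
by rewrite -trmx_exp !mxE.
Qed.

Lemma trmx_cpowm (R : realType) (n : nat) (z : R[i]) (M : 'M[R[i]]_n.+1) :
  (cpowm z M)^T = cpowm z M^T.
Proof. by rewrite /cpowm trmx_expm linearZ. Qed.

(** A diagonal matrix is symmetric. Hence so are the powers z^(2J) and z^(-2J), and the transpose of
    z^(-2J) C_k z^(2J) is z^(2J) C_k^T z^(-2J). *)
Lemma trmx_mxJ (R : realType) (n : nat) : (mxJ R n)^T = mxJ R n.
Proof.
rewrite /mxJ raddf_sum /=; apply: eq_bigr => i _.
by rewrite linearZ /= trmx_delta.
Qed.

Lemma trmx_cmx (R : realType) (n : nat) (M : 'M[R]_n.+1) :
  (cmx M)^T = cmx M^T.
Proof. by rewrite /cmx map_trmx. Qed.

Lemma cmxM (R : realType) (n : nat) (X Y : 'M[R]_n.+1) :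
  cmx (X *m Y) = cmx X *m cmx Y.
Proof. exact: map_mxM. Qed.

Lemma cmxZ (R : realType) (n : nat) (r : R) (X : 'M[R]_n.+1) :
  cmx (r *: X) = r%:C *: cmx X.
Proof. exact: map_mxZ. Qed.

End Matrices.

Section ComplexIntegral.
Variable R : realType.
Implicit Types f g : R -> R[i].

Lemma cintegral0 : cintegrable (fun=> 0 : R[i]) /\ cintegral (fun=> 0 : R[i]) = 0.
Proof.
split; first by split; exact: integrable0.
by rewrite /cintegral /= /Rintegral !integral0.
Qed.

(** Integrability is concluded together with the value, here and below, so that these rules can be
    chained and used in inductions. *)
Lemma cintegralD f g : cintegrable f -> cintegrable g ->
  cintegrable (fun t => f t + g t) /\
  cintegral (fun t => f t + g t) = cintegral f + cintegral g.
Proof.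
move=> [fr fi] [gr gi].
have ReD t : complex.Re (f t + g t) = complex.Re (f t) + complex.Re (g t).
  by case: (f t) (g t) => ? ? [].
have ImD t : complex.Im (f t + g t) = complex.Im (f t) + complex.Im (g t).
  by case: (f t) (g t) => ? ? [].
split.
  split; under eq_fun do rewrite ?ReD ?ImD EFinD; exact: integrableD.
rewrite /cintegral; under eq_Rintegral do rewrite ReD.
under [X in _ +i* X]eq_Rintegral do rewrite ImD.
by rewrite !RintegralD.
Qed.

(** A complex scalar mixes real and imaginary parts, so each part of the product is a real linear
    combination of both parts of [f]. *)
Lemma cintegralZl (c : R[i]) f : cintegrable f ->
  cintegrable (fun t => c * f t) /\
  cintegral (fun t => c * f t) = c * cintegral f.
Proof.
case: c => a b [fr fi].
have ReM t : complex.Re ((a +i* b) * f t)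
    = a * complex.Re (f t) - b * complex.Im (f t) by case: (f t).
have ImM t : complex.Im ((a +i* b) * f t)
    = a * complex.Im (f t) + b * complex.Re (f t) by case: (f t).
have Z (r : R) (h : R -> R) :
    lebesgue_measure.-integrable [set: R] (fun t => (h t)%:E) ->
    lebesgue_measure.-integrable [set: R] (fun t => (r * h t)%:E).
  by move=> ih; under eq_fun do rewrite EFinM; exact: integrableZl.
split.
  split; under eq_fun do rewrite ?ReM ?ImM ?EFinB ?EFinD.
    by apply: integrableB => //; exact: Z.
  by apply: integrableD => //; exact: Z.
rewrite /cintegral; under eq_Rintegral do rewrite ReM.
under [X in _ +i* X]eq_Rintegral do rewrite ImM.
rewrite RintegralB ?RintegralD ?RintegralZl //; exact: Z.
Qed.

Lemma cintegral_sum (I : Type) (r : seq I) (F : I -> R -> R[i]) :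
  (forall k, cintegrable (F k)) ->
  cintegrable (fun t => \sum_(k <- r) F k t) /\
  cintegral (fun t => \sum_(k <- r) F k t) = \sum_(k <- r) cintegral (F k).
Proof.
move=> iF; elim: r => [|k r [iS eS]].
  by under eq_fun do rewrite big_nil; rewrite big_nil; exact: cintegral0.
under eq_fun do rewrite big_cons.
by have [iD ->] := cintegralD (iF k) iS; rewrite big_cons eS.
Qed.

End ComplexIntegral.

Section PathIntegral.
Variables (R : realType) (n : nat) (g : R -> R[i]).
Implicit Types (F : R[i] -> 'M[R[i]]_n.+1) (A : 'M[R[i]]_n.+1).

Lemma path_integral_tr F : path_integrable g F ->
  path_integrable g (fun z => (F z)^T) /\
  path_integral g (fun z => (F z)^T) = (path_integral g F)^T.
Proof.
move=> iF; split.
  by move=> i j; under eq_fun do rewrite mxE; exact: iF.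
by apply/matrixP => i j; rewrite !mxE; under eq_fun do rewrite mxE.
Qed.

(** Each entry of the product is a finite combination of entries of [F] with constant complex
    coefficients. *)
Lemma path_integral_mulmxl A F : path_integrable g F ->
  path_integrable g (fun z => A *m F z) /\
  path_integral g (fun z => A *m F z) = A *m path_integral g F.
Proof.
move=> iF.
have E i j : (fun t => (A *m F (g t)) i j * velocity g t)
    = (fun t => \sum_k A i k * (F (g t) k j * velocity g t)).
  by apply/funext => t; rewrite mxE mulr_suml; apply: eq_bigr => k _; rewrite mulrA.
have iAF i j k := cintegralZl (A i k) (iF k j).
split=> [i j|].
  by rewrite E; apply: (cintegral_sum _ _).1 => k; exact: (iAF i j k).1.
apply/matrixP => i j; rewrite !mxE E.
rewrite (cintegral_sum _ (fun k => (iAF i j k).1)).2.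
by apply: eq_bigr => k _; rewrite (iAF i j k).2 mxE.
Qed.

(** Reduced to left multiplication by writing F A as the transpose of A^T F^T. *)
Lemma path_integral_mulmxr A F : path_integrable g F ->
  path_integrable g (fun z => F z *m A) /\
  path_integral g (fun z => F z *m A) = path_integral g F *m A.
Proof.
move=> /path_integral_tr[iF eF].
have [iAF eAF] := path_integral_mulmxl A^T iF.
have [] := path_integral_tr iAF.
by under eq_fun do rewrite trmx_mul !trmxK; rewrite eAF eF trmx_mul !trmxK.
Qed.

Lemma path_integral_sum (I : Type) (r : seq I)
    (F : I -> R[i] -> 'M[R[i]]_n.+1) :
  (forall k, path_integrable g (F k)) ->
  path_integrable g (fun z => \sum_(k <- r) F k z) /\
  path_integral g (fun z => \sum_(k <- r) F k z) =
    \sum_(k <- r) path_integral g (F k).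
Proof.
move=> iF.
have E i j : (fun t => (\sum_(k <- r) F k (g t)) i j * velocity g t)
    = (fun t => \sum_(k <- r) F k (g t) i j * velocity g t).
  by apply/funext => t; rewrite summxE mulr_suml.
have iFij i j k := iF k i j.
split=> [i j|]; first by rewrite E; exact: (cintegral_sum _ (iFij i j)).1.
apply/matrixP => i j; rewrite mxE E (cintegral_sum _ (iFij i j)).2 summxE.
by apply: eq_bigr => k _; rewrite mxE.
Qed.

End PathIntegral.

(** Separation of variables: with [a] and [b] the exponential factors in z and in w, each summand is
    the transposed integrand of the first representation, times [Q k], times the integrand of the
    second. *)
Lemma Mker_sum (R : realType) (n : nat) (J2 : 'M[R[i]]_n.+1)
    (C D Q : nat -> 'M[R[i]]_n.+1) (m : nat) (z w a b : R[i]) :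
  J2^T = J2 ->
  (a * b) *: Mker J2 C D Q m z w =
    \sum_(k < m)
      ((a / z ^+ k.+1) *: (cpowm z (- J2) *m C k *m cpowm z J2))^T *m
      (Q k *m ((b * w ^+ k) *: (cpowm w J2 *m D k *m cpowm w (- J2)))).
Proof.
move=> trJ2.
have trp : (cpowm z J2)^T = cpowm z J2 by rewrite trmx_cpowm trJ2.
have trn : (cpowm z (- J2))^T = cpowm z (- J2).
  by rewrite trmx_cpowm; congr (cpowm z _); rewrite raddfN /= trJ2.
(* From here on the matrix powers are opaque, those of z being symmetric, and the claim is plain
   algebra. *)
rewrite /Mker; move: trp trn.
move: (cpowm z J2) (cpowm z (- J2)) => zp zn trp trn.
move: (cpowm w J2) (cpowm w (- J2)) => wp wn.
set rhs := RHS; rewrite mulmx_sumr mulmx_suml scaler_sumr {}/rhs.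
apply: eq_bigr => k _.
rewrite [trmx (_ *: _)]linearZ /= !trmx_mul trp trn.
rewrite -!scalemxAr -!scalemxAl -?scalemxAr !scalerA !mulmxA.
(* The final factor 1/z of the kernel raises z^k to the z^(k+1) of the first representation. *)
by congr (_ *: _); rewrite expr_div_n exprS invfM; ring.
Qed.

(** The Gaussian factor e^(-(x^2+y^2)/2) is written as e^((x^2-y^2)/2) / e^(x^2): the first part is
    the prefactor of the theorem, and the denominator is to cancel the e^(x^2) of the second
    representation. *)
Lemma trmx_Phi_mul (R : realType) (n : nat) (nu : 'I_n -> R)
    (Phat : nat -> 'M[{poly R}]_n.+1) (S : nat -> 'M[R]_n.+1) (k : nat)
    (x y : R) :
  let PE t := Ppoly nu Phat k t *m expm (t ^+ 2 *: mxB nu) in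
  (S k)^T = S k ->
  (Phi nu Phat S k y)^T *m Phi nu Phat S k x =
    (expR ((x ^+ 2 - y ^+ 2) / 2) / expR (x ^+ 2)) *:
      ((PE y)^T *m (S k *m S k) *m PE x).
Proof.
move=> PE trS; rewrite /Phi -!(mulmxA (S k)) -/(PE x) -/(PE y).
move: (PE x) (PE y) => X Y.
rewrite [trmx (_ *: _)]linearZ /= trmx_mul trS -scalemxAr -scalemxAl scalerA.
by rewrite !mulmxA -expRN -!expRD; congr (expR _ *: _); field.
Qed.

Theorem corollary2p2 (R : realType) (d : nat) (nu : 'I_d -> R)
    (Phat : nat -> 'M[{poly R}]_d.+1) (S : nat -> 'M[R]_d.+1)
    (C D : nat -> 'M[R[i]]_d.+1) (gamma : R -> R[i]) (L : R) :
  let B := mxB nu in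
  let J2 := cmx (2 *: mxJ R d) in
  let W := weight nu in
  let P := Ppoly nu Phat in
  let Nsq := fun k => normsq W (P k) in
  let Ninv2 := fun k => cmx (invmx (Nsq k)) in
  let M := Mker J2 C D Ninv2 in
  let I := vertical_path L in
  monic_MOP W Phat ->
  (forall k, is_pos_sqrt (invmx (Nsq k)) (S k)) ->
  loop_contour gamma ->
  0 < L ->
  (forall t, complex.Re (gamma t) < L) ->
  (forall (x : R) (k : nat),
     let F := fun z : R[i] => (cexp (- z ^+ 2 + 2 * z * x%:C) / z ^+ k.+1) *:
                (cpowm z (- J2) *m C k *m cpowm z J2) in
     path_integrable gamma F /\
     cmx (P k x *m expm (x ^+ 2 *: B)) = path_integral gamma F) ->
  (forall (x : R) (k : nat),
     let F := fun w : R[i] => (cexp (w ^+ 2 - 2 * x%:C * w) * w ^+ k) *: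
                (cpowm w J2 *m D k *m cpowm w (- J2)) in
     path_integrable I F /\
     cmx (P k x *m expm (x ^+ 2 *: B)) =
       (expR (x ^+ 2))%:C *: path_integral I F) ->
  forall (n : nat) (x y : R),
    let G := fun w z : R[i] =>
      cexp (w ^+ 2 - 2 * x%:C * w - z ^+ 2 + 2 * z * y%:C) *: M n z w in
    [/\ forall s : R, path_integrable gamma (G (I s)),
        path_integrable I (fun w => path_integral gamma (G w))
      & cmx (CDkernel nu Phat S n x y) =
          (expR ((x ^+ 2 - y ^+ 2) / 2))%:C *:
            path_integral I (fun w => path_integral gamma (G w))].
Proof.
move=> B J2 W P Nsq Ninv2 M I _ HS _ _ _ HC HD n x y G.
(* The first representation is used at y, the second at x. *)
pose Fz (k : 'I_n) (z : R[i]) : 'M[R[i]]_d.+1 :=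
  (cexp (- z ^+ 2 + 2 * z * y%:C) / z ^+ k.+1) *:
    (cpowm z (- J2) *m C k *m cpowm z J2).
pose Hw (k : 'I_n) (w : R[i]) : 'M[R[i]]_d.+1 :=
  (cexp (w ^+ 2 - 2 * x%:C * w) * w ^+ k) *:
    (cpowm w J2 *m D k *m cpowm w (- J2)).
have trJ2 : J2^T = J2 by rewrite /J2 trmx_cmx linearZ /= trmx_mxJ.
have GE w : G w = fun z => \sum_(k < n) (Fz k z)^T *m (Ninv2 k *m Hw k w).
  apply/funext => z; rewrite /Fz /Hw -(Mker_sum _ _ _ _ _ _ _ _ trJ2) -cexpD.
  by congr (cexp _ *: _); ring.
(* For fixed w, the factor to the right of the transposed [Fz k z] is constant in z. *)
have inner_int w := path_integral_sum (index_enum 'I_n)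
  (fun k => (path_integral_mulmxr (Ninv2 k *m Hw k w)
              (path_integral_tr (HC y k).1).1).1).
(* Integrating over z leaves a sum of constant matrices times [Hw k w], which left linearity
   handles. *)
have innerE : (fun w => path_integral gamma (G w)) =
    fun w => \sum_(k < n)
      (cmx (P k y *m expm (y ^+ 2 *: B)))^T *m Ninv2 k *m Hw k w.
  apply/funext => w; rewrite GE (inner_int w).2; apply: eq_bigr => k _.
  have [iT eT] := path_integral_tr (HC y k).1.
  by rewrite (path_integral_mulmxr _ iT).2 eT -(HC y k).2 mulmxA.
have outer k := path_integral_mulmxl
  ((cmx (P k y *m expm (y ^+ 2 *: B)))^T *m Ninv2 k) (HD x k).1.
have [outer_int outerE] :=
  path_integral_sum (index_enum 'I_n) (fun k : 'I_n => (outer k).1).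
(* The integrability of the outer integrand is [outer_int]. *)
rewrite innerE; split => //.
  by move=> s; rewrite GE; exact: (inner_int _).1.
rewrite outerE scaler_sumr /CDkernel /cmx raddf_sum /=; apply: eq_bigr => k _.
have [[trS _] SS] := HS k.
rewrite (outer k).2 (trmx_Phi_mul _ _ _ _ trS) SS.
rewrite -[map_mx _ _]/(cmx _) cmxZ 2!cmxM -trmx_cmx (HD x k).2.
(* Here e^(x^2) cancels. *)
by rewrite -scalemxAr scalerA -rmorphM /= divfK ?expR_eq0.
Qed.
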